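(* For any nonempty bounded set $T\subset\mathbb{R}^d$, $$\Psi^{\mathrm{loc}}(T)\le\Psi(T)\le4\,\Psi^{\mathrm{loc}}(T).$$
   Context: $B_2^d$ is the closed Euclidean unit ball. For $A,B\subset\mathbb{R}^d$, the packing number is $M(A,B)=\sup\{|A_0|:A_0\subset A\text{ finite},\ x-y\notin B\text{ for all distinct }x,y\in A_0\}$. For $\varepsilon>0$ the local and global packing entropies of $T$ are $$h^{\mathrm{loc}}_T(\varepsilon)=\sup_{\delta\ge\varepsilon}\sup_{x\in T}\log M\big(T\cap(x+2\delta B_2^d),\delta B_2^d\big),\qquad h_T(\varepsilon)=\log M(T,\varepsilon B_2^d).$$ The local and global Sudakov minorations are $$\Psi^{\mathrm{loc}}(T)=\sup_{\varepsilon>0}\varepsilon\sqrt{h^{\mathrm{loc}}_T(\varepsilon)},\qquad\Psi(T)=\sup_{\varepsilon>0}\varepsilon\sqrt{h_T(\varepsilon)} .$$ *)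

(* Defs.v *)
From mathcomp Require Import all_boot all_order all_algebra.
From mathcomp Require Import finmap.
From mathcomp Require Import all_classical all_reals all_analysis.
Set Implicit Arguments.
Unset Strict Implicit.
Unset Printing Implicit Defensive.
Import Order.TTheory GRing.Theory Num.Theory.
Import numFieldNormedType.Exports.
Local Open Scope classical_set_scope.
Local Open Scope ring_scope.
Local Open Scope ereal_scope.

(* The canonical norm on 'rV[R]_d is the sup norm, so the Euclidean norm is
   written out. *)
Definition euclidean_norm {R : realType} {d : nat} (x : 'rV[R]_d) : R :=
  Num.sqrt (\sum_(i < d) x ord0 i ^+ 2)%R.

Definition unit_ball {R : realType} {d : nat} : set 'rV[R]_d :=
  [set x | (euclidean_norm x <= 1)%R].

Definition dilate {R : realType} {d : nat} (r : R) (B : set 'rV[R]_d) :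
    set 'rV[R]_d :=
  [set (r *: x)%R | x in B].

Definition translate {R : realType} {d : nat} (a : 'rV[R]_d)
    (B : set 'rV[R]_d) : set 'rV[R]_d :=
  [set (a + x)%R | x in B].

(* Suprema are taken in \bar R, so they may a priori be +oo. *)
Definition packing_number {R : realType} {d : nat} (A B : set 'rV[R]_d) :
    \bar R :=
  ereal_sup [set (#|` A0|%:R)%:E | A0 in [set A0 : {fset 'rV[R]_d} |
    [set` A0] `<=` A /\
    forall x y, x \in A0 -> y \in A0 -> x <> y -> ~ B (x - y)%R]].

Definition local_packing_entropy {R : realType} {d : nat} (T : set 'rV[R]_d)
    (e : R) : \bar R :=
  ereal_sup [set
    ereal_sup [set
      lne (packing_number
             (T `&` translate x (dilate (2 * delta)%R unit_ball))
             (dilate delta unit_ball)) | x in T]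
    | delta in [set delta : R | (e <= delta)%R]].

Definition packing_entropy {R : realType} {d : nat} (T : set 'rV[R]_d)
    (e : R) : \bar R :=
  lne (packing_number T (dilate e unit_ball)).

Definition local_sudakov {R : realType} {d : nat} (T : set 'rV[R]_d) :
    \bar R :=
  ereal_sup [set e%:E * sqrte (local_packing_entropy T e)
    | e in [set e : R | (0 < e)%R]].

Definition sudakov {R : realType} {d : nat} (T : set 'rV[R]_d) : \bar R :=
  ereal_sup [set e%:E * sqrte (packing_entropy T e)
    | e in [set e : R | (0 < e)%R]].

(* Main.v *)
(* Fix a finite l bounding the local minoration. Inside an e-separated set A,
   choose a maximal 2e-separated subset N: the balls of radius 2e centred at N
   cover A, and each of them meets A in a local packing, so
   |A| <= |N| exp ((l / e) ^ 2). Doubling e until it exceeds the diameter of T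
   leaves a geometric series, dominated by exp ((4 l / e) ^ 2). *)
Require Import Defs.
From mathcomp Require Import all_boot all_order all_algebra.
From mathcomp Require Import finmap.
From mathcomp Require Import all_classical all_reals all_analysis.
From mathcomp Require Import ring lra.
Import Order.TTheory GRing.Theory Num.Theory.
Import numFieldNormedType.Exports.
Local Open Scope classical_set_scope.
Local Open Scope ring_scope.
Local Open Scope ereal_scope.

(** * Finite sets: maximal independent subsets and unions *)

Lemma exists_maximal_independent_fset {K : choiceType} (r : rel K)
    (A : {fset K}) : symmetric r -> reflexive r ->
  exists N : {fset K}, [/\ {subset N <= A},
    (forall x y, x \in N -> y \in N -> x <> y -> ~~ r x y) &
    forall x, x \in A -> exists2 y, y \in N & r y x].
Proof.
move=> rC rr; elim/finSet_rect: A => A IH.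
have [->|[a aA]] := fset_0Vmem A; first by exists fset0; split.
have [N [NA Nind Ncov]] := IH _ (fproperD1 aA).
have NsA x : x \in N -> x \in A by move=> /NA; rewrite !inE => /andP[].
(* If [N], obtained for [A] without [a], already dominates [a], it is kept; otherwise adding [a]
   preserves independence. *)
have [[b bN rba]|nr] := pselect (exists2 b, b \in N & r b a).
  exists N; split=> // x xA; have [->|xa] := eqVneq x a; first by exists b.
  by apply: Ncov; rewrite !inE xa.
have nra b : b \in N -> ~~ r b a.
  by move=> bN; apply/negP => rba; apply: nr; exists b.
exists (a |` N)%fset; split.
- by move=> x; rewrite !inE => /orP[/eqP->//|/NsA].
- move=> x y; rewrite !inE => /orP[/eqP->|xN] /orP[/eqP->|yN] // nxy.
  + by rewrite rC nra.
  + exact: nra.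
  + exact: Nind.
- move=> x xA; have [->|xa] := eqVneq x a.
    by exists a; rewrite ?rr// !inE eqxx.
  have [|y yN ryx] := Ncov x; first by rewrite !inE xa.
  by exists y; rewrite // !inE yN orbT.
Qed.

Lemma leq_card_bigfcup {I K : choiceType} (s : seq I) (F : I -> {fset K}) :
  (#|` \bigcup_(i <- s) F i|%fset <= \sum_(i <- s) #|` F i|)%N.
Proof.
elim: s => [|i s IH]; first by rewrite !big_nil cardfs0.
rewrite !big_cons; apply: leq_trans (leq_card_fsetU _ _) _.
by rewrite leq_add2l.
Qed.

(** * The Euclidean norm and its balls *)

Section EuclideanNorm.
Context {R : realType} {d : nat}.
Implicit Types (x y : 'rV[R]_d) (r : R).

Lemma euclidean_normZ r x :
  euclidean_norm (r *: x)%R = (`|r| * euclidean_norm x)%R.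
Proof.
rewrite /euclidean_norm -sqrtr_sqr -sqrtrM ?sqr_ge0//; congr (Num.sqrt _).
by rewrite mulr_sumr; apply: eq_bigr => i _; rewrite mxE exprMn.
Qed.

Lemma euclidean_norm0 : euclidean_norm (0 : 'rV[R]_d) = 0%R.
Proof. by rewrite -(scale0r 0%R) euclidean_normZ normr0 mul0r. Qed.

Lemma euclidean_distC x y :
  euclidean_norm (x - y)%R = euclidean_norm (y - x)%R.
Proof. by rewrite -opprB -scaleN1r euclidean_normZ normrN1 mul1r. Qed.

(** Each of the [d] squared coordinates is at most the square of the sup norm. This carries
    boundedness, stated in the sup norm, over to Euclidean distances. *)
Lemma euclidean_norm_le_mx_norm x :
  (euclidean_norm x <= Num.sqrt d%:R * `|x|)%R.
Proof.
rewrite -[leRHS]ger0_norm ?mulr_ge0// -sqrtr_sqr ler_wsqrtr//.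
rewrite exprMn sqr_sqrtr ?ler0n//.
have -> : (d%:R * `|x| ^+ 2 = \sum_(i < d) `|x| ^+ 2)%R.
  by rewrite sumr_const card_ord mulr_natl.
apply: ler_sum => i _; rewrite -real_normK ?num_real// ler_sqr ?nnegrE//.
by rewrite [leRHS]/Num.Def.normr /= mx_normrE; apply: (le_bigmax _ _ (ord0, i)).
Qed.

Lemma dilate_unit_ballE r x : (0 < r)%R ->
  dilate r unit_ball x <-> (euclidean_norm x <= r)%R.
Proof.
move=> r0; split=> [[y y1 <-]|xr].
  by rewrite euclidean_normZ gtr0_norm// ler_piMr// ltW.
exists (r^-1 *: x)%R; last by rewrite scalerA divff ?scale1r// gt_eqF.
rewrite /unit_ball/= euclidean_normZ gtr0_norm ?invr_gt0//.
by rewrite ler_pdivrMl// mulr1.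
Qed.

Lemma translate_dilate_unit_ballE r x y : (0 < r)%R ->
  translate x (dilate r unit_ball) y <-> (euclidean_norm (y - x) <= r)%R.
Proof.
move=> r0; split=> [[z /(dilate_unit_ballE _ _ r0) zr <-]|].
  by rewrite addrC addKr.
by move=> /(dilate_unit_ballE _ _ r0) yr; exists (y - x)%R; rewrite // subrKC.
Qed.

End EuclideanNorm.

(** * Packing numbers and entropies *)

Section Packing.
Context {R : realType} {d : nat}.
Implicit Types (A B T : set 'rV[R]_d) (e l c : R).

(** The inequality is strict because the ball that differences must avoid is closed. *)
Definition separated e (A0 : {fset 'rV[R]_d}) : Prop :=
  forall x y, x \in A0 -> y \in A0 -> x <> y -> (e < euclidean_norm (x - y))%R.

Lemma packing_number_leP A e c : (0 < e)%R ->
  packing_number A (dilate e unit_ball) <= c%:E <->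
  forall A0 : {fset 'rV[R]_d}, [set` A0] `<=` A -> separated e A0 ->
    (#|` A0|%:R <= c)%R.
Proof.
move=> e0; split=> [Mc A0 A0A sep|cA].
  rewrite -lee_fin; apply: le_trans Mc; apply: ereal_sup_ubound.
  exists A0 => //; split=> // x y xA yA xy /(dilate_unit_ballE _ _ e0).
  by rewrite leNgt sep.
apply: ge_ereal_sup => _ [A0 [A0A sep] <-]; rewrite lee_fin cA// => x y xA yA xy.
by rewrite ltNge; apply/negP => /(dilate_unit_ballE _ _ e0); exact: sep.
Qed.

Lemma packing_number_ge1 A B : A !=set0 -> 1 <= packing_number A B.
Proof.
move=> [a Aa]; apply: ereal_sup_ubound; exists [fset a]%fset.
  split=> [x/=|x y]; rewrite !inE; first by move=> /eqP->.
  by move=> /eqP-> /eqP->.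
by rewrite cardfs1.
Qed.

Lemma packing_number_ge0 A B : 0 <= packing_number A B.
Proof.
apply: ereal_sup_ubound; exists fset0; last by rewrite cardfs0.
by split=> [x|x y]; rewrite /= inE.
Qed.

Lemma le_packing_number A A' B B' : A `<=` A' -> B' `<=` B ->
  packing_number A B <= packing_number A' B'.
Proof.
move=> AA BB; apply: ereal_sup_le => _ [A0 [A0A sep] <-]; exists A0 => //.
split=> [x /A0A/AA//|x y xA yA xy /BB]; exact: sep.
Qed.

Lemma dilate_unit_ball_subset e e' : (0 < e)%R -> (e <= e')%R ->
  dilate e unit_ball `<=` dilate e' (@unit_ball R d).
Proof.
move=> e0 ee x /(dilate_unit_ballE _ _ e0) xe.
by apply/dilate_unit_ballE; [exact: lt_le_trans ee|exact: le_trans ee].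
Qed.

Lemma lne_packing_number_le A B c :
  lne (packing_number A B) <= c%:E -> packing_number A B <= (expR c)%:E.
Proof.
rewrite -lee_expeR lneK// in_itv/= packing_number_ge0; exact: leey.
Qed.

Lemma lne_packing_number_ge0 A B : A !=set0 -> 0 <= lne (packing_number A B).
Proof. by move=> A0; rewrite lne_ge0 packing_number_ge1. Qed.

(** Intersecting [T] with a ball shrinks the set, and a scale [delta] at least [e] enlarges the
    excluded ball; both lower the packing number. *)
Lemma local_packing_entropy_le T e : T !=set0 -> (0 < e)%R ->
  local_packing_entropy T e <= packing_entropy T e.
Proof.
move=> T0 e0; apply: ge_ereal_sup => _ [r /= er <-].
apply: ge_ereal_sup => _ [x Tx <-].
rewrite /packing_entropy lee_lne ?in_itv/= ?packing_number_ge0 ?leey//.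
by apply: le_packing_number => [y []//|]; exact: dilate_unit_ball_subset.
Qed.

Lemma mul_sqrte_le (h : \bar R) e l : (0 < e)%R ->
  e%:E * sqrte h <= l%:E -> h <= ((l / e) ^+ 2)%:E.
Proof.
move=> e0; rewrite -lee_pdivlMl// -EFinM mulrC => hl.
(* The sign lets [l / e] be rewritten as the square root of its square. *)
have l0 : (0 <= l / e)%R by rewrite -lee_fin (le_trans _ hl)// sqrte_ge0.
by rewrite -lee_sqrt ?lee_fin ?sqr_ge0//= sqrtr_sqr ger0_norm.
Qed.

(** * Cardinality of separated sets, from one scale to all scales *)

Lemma local_packing_card_le T e l x (A0 : {fset 'rV[R]_d}) :
  (0 < e)%R -> local_sudakov T <= l%:E -> T x ->
  [set` A0] `<=` T -> (forall y, y \in A0 -> euclidean_norm (y - x) <= 2 * e)%R ->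
  separated e A0 -> (#|` A0|%:R <= expR ((l / e) ^+ 2))%R.
Proof.
move=> e0 Ll Tx A0T A0x sep.
have e20 : (0 < 2 * e)%R by rewrite mulr_gt0.
pose A := T `&` translate x (dilate (2 * e)%R unit_ball).
suff : packing_number A (dilate e unit_ball) <= (expR ((l / e) ^+ 2))%:E.
  move=> /(packing_number_leP _ _ _ e0); apply=> // y /= yA0; split.
    exact: A0T.
  by apply/translate_dilate_unit_ballE => //; exact: A0x.
(* Of the two suprema in the local entropy, only the scale [delta = e] and the centre [x] are
   used. *)
apply: lne_packing_number_le; apply: (@le_trans _ _ (local_packing_entropy T e)).
  apply: le_ereal_sup_tmp; eexists; first by exists e => /=.
  by apply: ereal_sup_ubound; exists x.
apply: mul_sqrte_le => //; apply: le_trans Ll.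
by apply: ereal_sup_ubound; exists e.
Qed.

(** Here [n] counts the doublings that bring [e] up to [D]. The induction varies [e] and [A0], since
    it passes to scale [2 * e] and to the centres [N]. *)
Lemma separated_card_le T e l n (D : R) (A0 : {fset 'rV[R]_d}) :
  (forall x y, T x -> T y -> euclidean_norm (x - y) <= D)%R ->
  local_sudakov T <= l%:E -> (0 < e)%R -> (D <= 2 ^+ n * e)%R ->
  [set` A0] `<=` T -> separated e A0 ->
  (#|` A0|%:R <= expR ((4 * l / e) ^+ 2))%R.
Proof.
move=> TD Ll; elim: n e A0 => [|n IH] e A0 e0 De A0T sep.
  (* Now [D] is at most [e], so two distinct points would be farther apart than the diameter bound
     allows. *)
  have A01 : (#|` A0| <= 1)%N.
    have [->|[a aA]] := fset_0Vmem A0; first by rewrite cardfs0.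
    suff A0a : (A0 `<=` [fset a])%fset.
      by have := fsubset_leq_card A0a; rewrite cardfs1.
    apply/fsubsetP => x xA; rewrite inE; apply/eqP; apply: contrapT => xa.
    move: (sep _ _ xA aA xa); rewrite expr0 mul1r in De.
    by rewrite ltNge (le_trans (TD _ _ _ _) De)//; exact: A0T.
  apply: (@le_trans _ _ 1%R); first by rewrite lern1.
  by rewrite -expR0 ler_expR sqr_ge0.
have e20 : (0 < 2 * e)%R by rewrite mulr_gt0.
(* The radius [2 * e] serves twice: independence is separation at the next scale, and the covering
   balls are those of the local packing at scale [e]. *)
have [||N [NA Nind Ncov]] := exists_maximal_independent_fset
  (fun x y : 'rV[R]_d => (euclidean_norm (y - x) <= 2 * e)%R) A0.
- by move=> x y; rewrite euclidean_distC.
- by move=> x; rewrite subrr euclidean_norm0 ltW.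
have cardN : (#|` N|%:R <= expR ((4 * l / (2 * e)) ^+ 2))%R.
  apply: IH => //.
  - by rewrite mulrA -exprSr.
  - by move=> x /NA /A0T.
  - by move=> x y xN yN xy; rewrite ltNge euclidean_distC Nind.
pose F (x : 'rV[R]_d) := [fset y in A0 | (euclidean_norm (y - x) <= 2 * e)%R]%fset.
have AF : (A0 `<=` \bigcup_(x <- N) F x)%fset.
  apply/fsubsetP => y yA; have [x xN xy] := Ncov _ yA.
  by apply/bigfcupP; exists x; rewrite ?xN// !inE yA.
have cardF x : x \in N -> (#|` F x|%:R <= expR ((l / e) ^+ 2))%R.
  move=> xN; apply: (@local_packing_card_le T e l x) => //.
  - exact/A0T/NA.
  - by move=> y /=; rewrite !inE => /andP[/A0T].
  - by move=> y; rewrite !inE => /andP[].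
  - by move=> y z; rewrite !inE => /andP[yA _] /andP[zA _]; exact: sep.
apply: (@le_trans _ _ (\sum_(x <- N) #|` F x|)%:R%R).
  rewrite ler_nat (leq_trans (fsubset_leq_card AF))//; exact: leq_card_bigfcup.
apply: (@le_trans _ _ (#|` N|%:R * expR ((l / e) ^+ 2))%R).
  (* The cardinality of [N] is written as a sum of ones, to compare termwise with the sizes of the
     [F x]. *)
  rewrite natr_sum -sum1_size natr_sum mulr_suml.
  rewrite big_seq [leRHS]big_seq; apply: ler_sum => x xN; rewrite mul1r.
  exact: cardF.
apply: (@le_trans _ _ (expR ((4 * l / (2 * e)) ^+ 2) * expR ((l / e) ^+ 2))%R).
  by rewrite ler_wpM2r ?expR_ge0.
rewrite -expRD ler_expR.
(* The exponents add up to [(4 + 1) * (l / e) ^+ 2], below the allowed [16 * (l / e) ^+ 2]. *)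
have -> : (4 * l / (2 * e) = 2 * (l / e))%R by field; rewrite gt_eqF.
by rewrite -mulrA; have := sqr_ge0 (l / e)%R; rewrite !exprMn; lra.
Qed.

Lemma bounded_set_euclidean_diameter T : bounded_set T ->
  exists D : R, forall x y, T x -> T y -> (euclidean_norm (x - y) <= D)%R.
Proof.
(* Boundedness gives a bound by every number strictly above [M], hence by [M + 1]. *)
move=> [M [_ TM]]; have M1 : (M < M + 1)%R by rewrite ltrDl.
exists (Num.sqrt d%:R * ((M + 1) + (M + 1)))%R => x y Tx Ty.
apply: le_trans (euclidean_norm_le_mx_norm _) _; rewrite ler_wpM2l ?sqrtr_ge0//.
by rewrite (le_trans (ler_normB _ _))// lerD//; exact: (TM _ M1).
Qed.

Lemma local_sudakov_ge0 T : 0 <= local_sudakov T.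
Proof.
apply: (@le_trans _ _ (1%:E * sqrte (local_packing_entropy T 1))).
  by rewrite mul1e sqrte_ge0.
by apply: ereal_sup_ubound; exists 1%R => /=.
Qed.

End Packing.

Theorem proposition5p6 (R : realType) (d : nat) (T : set 'rV[R]_d)
    (T_nonempty : T !=set0) (T_bounded : bounded_set T) :
  local_sudakov T <= sudakov T /\ sudakov T <= 4%:E * local_sudakov T.
Proof.
split.
  apply: ge_ereal_sup => _ [e /= e0 <-].
  apply: (@le_trans _ _ (e%:E * sqrte (packing_entropy T e))); last first.
    by apply: ereal_sup_ubound; exists e.
  (* Comparing square roots requires the global entropy to be nonnegative: a nonempty set has
     packing number at least 1. *)
  rewrite lee_pmul2l// lee_sqrt ?local_packing_entropy_le//.
  exact: lne_packing_number_ge0.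
(* Nonnegativity excludes [-oo], and for [+oo] the bound is trivial; a finite [l] remains. *)
have := local_sudakov_ge0 T; case L : (local_sudakov T) => [l| |] // l0; last first.
  by rewrite mulry gtr0_sg// mul1e leey.
have [D TD] := bounded_set_euclidean_diameter T T_bounded.
apply: ge_ereal_sup => _ [e /= e0 <-].
rewrite -lee_pdivlMl// -!EFinM.
have le0 : (0 <= 4 * l / e)%R.
  by rewrite divr_ge0 ?mulr_ge0// ltW.
(* Writing [4 * l / e] as a square root and then exponentiating turns the goal into a bound on the
   packing number. *)
rewrite mulrC -(ger0_norm le0) -sqrtr_sqr.
rewrite -[leRHS]/(sqrte ((4 * l / e) ^+ 2)%:E) lee_sqrt ?lee_fin ?sqr_ge0//.
rewrite /packing_entropy.
rewrite -lee_expeR lneK ?in_itv/= ?packing_number_ge0 ?leey//.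
apply/packing_number_leP => // A0 A0T sep.
(* Powers of two eventually exceed [D / e], so finitely many doublings suffice. *)
have [n Dn] : exists n, (D <= 2 ^+ n * e)%R.
  exists (Num.bound (D / e)); rewrite -ler_pdivrMr//.
  exact/ltW/upper_nthrootP.
by apply: (@separated_card_le R d T e l n D); rewrite // L.
Qed.
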